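(* Let $H=(V,\mathcal{E})$ be a hypergraph. Then every partial sub-hypergraph $H'$ of $H$ satisfies $\nu^*(H')=\tau^*(H')$ if and only if $H$ has no partial sub-hypergraph isomorphic to the tail hypergraph.
   Context: A hypergraph is a pair $H=(V,\mathcal{E})$ where $V$ is a set (possibly infinite) and $\mathcal{E}$ is a set of subsets of $V$ (edges, possibly infinite). A fractional matching is $f:\mathcal{E}\to\mathbb{R}_{\ge0}$ with $\sum_{E\ni v}f(E)\le1$ for every $v\in V$; its size is $|f|=\sum_{E\in\mathcal{E}}f(E)$. A fractional cover is $g:V\to\mathbb{R}_{\ge0}$ with $\sum_{v\in E}g(v)\ge1$ for every $E\in\mathcal{E}$; its size is $|g|=\sum_{v\in V}g(v)$. (Sums of nonnegative terms are suprema of finite partial sums and may be $\infty$.) $\nu^*(H)=\sup\{|f|\}$ over fractional matchings and $\tau^*(H)=\inf\{|g|\}$ over fractional covers; both may be infinite. A partial sub-hypergraph of $H$ is $H'=(V',\mathcal{E}')$ with $V'\subseteq V$ and $\mathcal{E}'=\{E\cap V':E\in\mathcal{E}_0\}$ for some $\mathcal{E}_0\subseteq\mathcal{E}$. The tail hypergraph is $(\mathbb{N},\{E_j:j\in\mathbb{N}\})$ with $E_j=\{i\in\mathbb{N}:i\ge j\}$. Isomorphism of hypergraphs is a bijection of vertex sets inducing a bijection of edge sets. *)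

(* Defs.v *)
From HB Require Import structures.
From mathcomp Require Import all_boot all_order all_algebra.
From mathcomp Require Import all_classical all_reals.
From mathcomp Require Import ereal esum.
Set Implicit Arguments. Unset Strict Implicit. Unset Printing Implicit Defensive.
Import Order.TTheory GRing.Theory Num.Theory.
Local Open Scope classical_set_scope.
Local Open Scope ring_scope.

(* A hypergraph with vertices in an ambient (choice) type T is given by a
   vertex set V : set T and an edge set E : set (set T), every edge being a
   subset of V.  Infinite sums of nonnegative reals are the extended-real
   sums [esum] (supremum of finite partial sums). *)

Definition is_hypergraph (T : Type) (V : set T) (E : set (set T)) : Prop :=
  forall e, E e -> e `<=` V.

Definition partial_sub (T : Type) (V : set T) (E : set (set T))
    (V' : set T) (E' : set (set T)) : Prop :=
  V' `<=` V /\ exists E0 : set (set T), E0 `<=` E /\ E' = [set e `&` V' | e in E0].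

Section Frac.
Variables (R : realType) (T : choiceType).

Definition frac_matching (V : set T) (E : set (set T)) (f : set T -> R) : Prop :=
  (forall e, E e -> 0 <= f e) /\
  (forall v, V v -> (\esum_(e in [set e | E e /\ e v]) (f e)%:E <= 1%E)%E).

Definition frac_matching_size (E : set (set T)) (f : set T -> R) : \bar R :=
  (\esum_(e in E) (f e)%:E)%E.

Definition frac_cover (V : set T) (E : set (set T)) (g : T -> R) : Prop :=
  (forall v, V v -> 0 <= g v) /\
  (forall e, E e -> (1%E <= \esum_(v in e) (g v)%:E)%E).

Definition frac_cover_size (V : set T) (g : T -> R) : \bar R :=
  (\esum_(v in V) (g v)%:E)%E.

Definition nu_star (V : set T) (E : set (set T)) : \bar R :=
  ereal_sup [set frac_matching_size E f | f in frac_matching V E].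

Definition tau_star (V : set T) (E : set (set T)) : \bar R :=
  ereal_inf [set frac_cover_size V g | g in frac_cover V E].

End Frac.

Definition tail_edge (j : nat) : set nat := [set i | (j <= i)%N].

Definition iso_tail (T : Type) (V : set T) (E : set (set T)) : Prop :=
  exists phi : T -> nat,
    set_bij V setT phi /\
    (forall e, E e -> e `<=` V) /\
    (forall e, E e -> exists j, phi @` e = tail_edge j) /\
    (forall j, exists e, E e /\ phi @` e = tail_edge j).

(* Main.v *)
(* Weak duality is an exchange of sums, and in the tail hypergraph nu* = 1 while
   tau* = oo.  Conversely, let nu* < c < c1 < tau*.  Finitely many edges always
   have a finitely supported fractional cover of size c, so there are such covers
   s_0, s_1, ... where s_n covers edges realizing every trace of an edge on the
   supports of s_0, ..., s_(n-1).  Convex combinations of the s_n, rescaled to size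
   c1, are not covers; by a minimax argument there are probability measures on
   edges giving each event "s_i almost fails to cover e" mass bounded below, and a
   measure-theoretic form of Ptak's lemma yields an ultrafilter on edges containing
   infinitely many of these events.  Let S be the set of vertices that belong to
   almost every edge, and let e_n be an edge covered by s_n, s_(n+1), ... having the
   same trace as S on the earlier supports.  Then infinitely many s_i give mass
   bounded below to e_n \ S for all n <= i, while every point of their supports
   outside S is in only finitely many e_n.  A second use of Ptak's lemma, now on
   vertices, extracts a half graph v_k \in e_(n_j) <-> j <= k, which is a tail.

   A finitely supported probability measure is represented by a list of points,
   with multiplicity. *)
Require Import Defs.
From HB Require Import structures.
From mathcomp Require Import all_boot all_order all_algebra.
From mathcomp Require Import all_classical all_reals.
From mathcomp Require Import ereal esum topology normedtype.
From mathcomp Require Import ring lra zify.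
Set Implicit Arguments. Unset Strict Implicit. Unset Printing Implicit Defensive.
Import Order.TTheory GRing.Theory Num.Theory.
Import numFieldNormedType.Exports.
Local Open Scope classical_set_scope.
Local Open Scope ring_scope.

(** * Approximate minimax against finitely many payoffs *)

(** The positive part y^+ lies in the nonnegative half-line, so the distance from y + a to that
    half-line is at most |y + a - y^+| = |a - y^-|. *)
Lemma sqr_neg_part_add (R : realType) (y a : R) :
  Num.max (- (y + a)) 0 ^+ 2 <= (Num.max (- y) 0 - a) ^+ 2.
Proof.
case: (lerP (- (y + a)) 0) => h1; case: (lerP (- y) 0) => h2.
- by rewrite expr0n sqr_ge0.
- by rewrite expr0n sqr_ge0.
- by nra.
- by nra.
Qed.

(* Blackwell approachability: greedily chosen points keep the squared norm of the
   negative part of the sum growing at most linearly. *)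
Lemma approx_minimax (R : realType) (X : choiceType) (J : finType) (D : set X)
    (a : X -> J -> R) (M : R) :
  (0 < #|J|)%N ->
  (forall x j, D x -> `|a x j| <= M) ->
  (forall w : J -> R, (forall j, 0 <= w j) -> \sum_j w j = 1 ->
     exists2 x, D x & 0 <= \sum_j w j * a x j) ->
  forall eps : R, 0 < eps -> exists s : seq X,
    [/\ s != [::], (forall x, x \in s -> D x) &
        forall j, - eps * (size s)%:R <= \sum_(x <- s) a x j].
Proof.
move=> J0 a1 ww eps eps0.
have cone (w : J -> R) : (forall j, 0 <= w j) ->
    exists2 x, D x & 0 <= \sum_j w j * a x j.
  move=> w0; have sw0 : 0 <= \sum_j w j by apply: sumr_ge0.
  have [sw|sw] := eqVneq (\sum_j w j) 0.
    have wE j : w j = 0.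
      move/eqP: sw; rewrite psumr_eq0; last by move=> i _; exact: w0.
      by move=> /allP /(_ j); rewrite mem_index_enum => /(_ erefl) /implyP /(_ erefl) /eqP.
    (* If all weights vanish, any point of [D] will do; uniform weights serve only to produce
       one. *)
    have [||x Dx _] := ww (fun=> #|J|%:R^-1).
    - by move=> j; rewrite invr_ge0.
    - rewrite sumr_const -(mulr_natr #|J|%:R^-1) mulVf// pnatr_eq0 -lt0n J0//.
    by exists x => //; rewrite big1// => j _; rewrite wE mul0r.
  have [||x Dx ax] := ww (fun j => w j / \sum_j w j).
  - by move=> j; rewrite divr_ge0.
  - by rewrite -mulr_suml divff.
  exists x => //; have := mulr_ge0 sw0 ax.
  rewrite mulr_sumr; congr (0 <= _); apply: eq_bigr => j _.
  by rewrite mulrA [_ * (_ / _)]mulrC divfK.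
have step n : exists s : seq X, [/\ size s = n, (forall x, x \in s -> D x) &
    \sum_j Num.max (- \sum_(x <- s) a x j) 0 ^+ 2 <= n%:R * (#|J|%:R * M ^+ 2)].
  elim: n => [|n [s [sn sD sle]]].
    exists [::]; split => //; rewrite mul0r big1// => j _.
    by rewrite big_nil oppr0 maxxx expr0n.
  pose w j := Num.max (- \sum_(x <- s) a x j) 0.
  have [|x Dx ax] := cone w; first by move=> j; rewrite le_max lexx orbT.
  exists (rcons s x); split; first by rewrite size_rcons sn.
    by move=> y; rewrite mem_rcons inE => /orP[/eqP ->|/sD].
  apply: (@le_trans _ _ (\sum_j (w j ^+ 2 - 2%:R * (w j * a x j) + M ^+ 2))).
    apply: ler_sum => j _; rewrite -cats1 big_cat big_seq1.
    apply: (le_trans (sqr_neg_part_add _ _)); rewrite -/(w j).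
    have := a1 x j Dx; rewrite ler_norml => /andP[l1 l2].
    have : 0 <= (M - a x j) * (M + a x j) by apply: mulr_ge0; lra.
    by set u := w j; set b := a x j; nra.
  rewrite !big_split/= sumrN -mulr_sumr -(natr1 n) mulrDl mul1r.
  have -> : \sum_(j : J) M ^+ 2 = #|J|%:R * M ^+ 2 by rewrite sumr_const mulr_natl.
  have {sle} : \sum_j w j ^+ 2 <= n%:R * (#|J|%:R * M ^+ 2) := sle.
  move: ax; set P := \sum_j w j * a x j; set S := \sum_j w j ^+ 2; lra.
have e2 : 0 < eps ^+ 2 by rewrite exprn_gt0.
(* With #|J| M^2 <= eps^2 n, the bound n #|J| M^2 on the square is at most (eps n)^2. *)
pose n := (Num.truncn (#|J|%:R * M ^+ 2 / eps ^+ 2)).+1.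
have nle : #|J|%:R * M ^+ 2 <= eps ^+ 2 * n%:R.
  have := truncnS_gt (#|J|%:R * M ^+ 2 / eps ^+ 2).
  by rewrite -/n ltr_pdivrMr// [ltRHS]mulrC => /ltW.
have [s [sn sD sle]] := step n.
exists s; split => //; first by rewrite -size_eq0 sn.
move=> j; rewrite sn.
have : Num.max (- \sum_(x <- s) a x j) 0 ^+ 2 <= n%:R * (#|J|%:R * M ^+ 2).
  apply: le_trans sle; rewrite (bigD1 j)//= lerDl.
  by apply: sumr_ge0 => i _; rewrite sqr_ge0.
set y := \sum_(x <- s) _; set m := Num.max _ _ => mle.
have m0 : 0 <= m by rewrite le_max lexx orbT.
have my : - y <= m by rewrite le_max lexx.
have en : 0 <= eps * n%:R by rewrite mulr_ge0// ltW.
suff : m <= eps * n%:R by lra.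
rewrite -(@ler_pXn2r _ 2)// exprMn (le_trans mle)//.
have := ler_wpM2l (ler0n R n) nle; lra.
Qed.

(** * Finitely additive measures and Ptak's lemma *)

Section FinitelyAdditive.
Variables (R : realType) (X : Type).

(** The total mass is only bounded by 1, so that [freq] of the empty list, which is identically 0,
    qualifies. *)
Record is_charge (m : set X -> R) : Prop := IsCharge {
  charge_ge0 : forall A, 0 <= m A;
  charge_le1 : forall A, m A <= 1;
  chargeU : forall A B, A `&` B = set0 -> m (A `|` B) = m A + m B }.

Variables (m : set X -> R) (mm : is_charge m).

Lemma charge0 : m set0 = 0.
Proof. by have := chargeU mm (setI0 set0); rewrite setU0; lra. Qed.

Lemma chargeID A B : m A = m (A `&` B) + m (A `\` B).
Proof.
rewrite -chargeU//; first by rewrite setUIDK.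
by rewrite setDE setIACA setICr setI0.
Qed.

Lemma le_charge A B : A `<=` B -> m A <= m B.
Proof.
move=> AB; rewrite (chargeID B A) (setIidr AB) lerDl; exact: charge_ge0.
Qed.

Lemma charge_subU A B C : A `<=` B `|` C -> m A <= m B + m C.
Proof.
move=> ABC; apply: (le_trans (le_charge ABC)).
rewrite -(setDUK (@subsetUl _ B C)) chargeU ?setDIK// lerD2l.
by apply: le_charge => x [[]].
Qed.

End FinitelyAdditive.

Lemma ultra_bigcup_nat (X : Type) (U : set_system X) (UU : UltraFilter U)
    (B : nat -> set X) (a b : nat) :
  U [set x | exists j, (a <= j < b)%N /\ B j x] -> exists j, (a <= j)%N /\ U (B j).
Proof.
elim: b => [|b IH] Uab.
  by have [x [j []]] := filter_ex Uab; rewrite ltn0 andbF.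
have [UB|UB] := in_ultra_setVsetC (B b) UU.
  have [ab|ba] := leqP a b; first by exists b.
  have [x [j [/andP[aj jb]]]] := filter_ex Uab; lia.
apply: IH; apply: filterS (filterI Uab UB) => x [[j [/andP[aj jb] Bj]] nB].
exists j; split => //; rewrite aj/= ltn_neqAle -ltnS jb andbT.
by apply: contra_notN nB => /eqP <-.
Qed.

(* Each K n is a finite union of sets B j with j >= n, chosen so large that the
   charge of B l outside K 0, ..., K n stays below delta: the K n then generate
   a proper filter, and an ultrafilter containing K n contains some B j. *)
Lemma charge_ultrafilter (R : realType) (X : Type) (m : set X -> R)
    (B : nat -> set X) (delta : R) :
  is_charge m -> 0 < delta -> (forall i, delta <= m (B i)) ->
  exists2 U : set_system X, UltraFilter U & forall n, exists j, (n <= j)%N /\ U (B j).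
Proof.
move=> mm d0 mB.
pose W n N : set X := [set x | exists j, (n <= j < N)%N /\ B j x].
have WS n N M : (N <= M)%N -> W n N `<=` W n M.
  by move=> NM x [j [/andP[nj jN] Bj]]; exists j; rewrite nj (leq_trans jN).
(* The charge of [W n N] grows with [N] and is at most 1, so an [N] nearly attaining the supremum
   leaves little to gain. *)
have exN n : exists N, forall M, m (W n M) <= m (W n N) + delta / 2 ^+ n.+1.
  pose S := range (fun N => m (W n N)).
  have Ssup : has_sup S.
    split; first by exists (m (W n 0%N)), 0%N.
    by exists 1 => _ [N _ <-]; exact: charge_le1.
  have [|_ [N _ <-] NS] := sup_adherent (_ : 0 < delta / 2 ^+ n.+1) Ssup.
    by rewrite divr_gt0// exprn_gt0.
  exists N => M; have := sup_upper_bound Ssup (ex_intro2 _ _ M I erefl).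
  by move: NS; lra.
have {exN} [N NP] := choice exN.
pose K n := W n (N n).
have BK k l : (k <= l)%N -> m (B l `\` K k) <= delta / 2 ^+ k.+1.
  move=> kl; pose M := maxn (N k) l.+1.
  have BM : B l `\` K k `<=` W k M `\` K k.
    move=> x [Bl nK]; split => //; exists l; split => //.
    by rewrite kl/= leq_max ltnSn orbT.
  apply: (le_trans (le_charge mm BM)).
  have := NP k M; rewrite (chargeID mm (W k M) (K k)) (setIidr _) /K; last first.
    by apply: WS; rewrite leq_maxl.
  by lra.
pose Q n : set X := [set x | forall k, (k < n)%N -> K k x].
(* The losses delta / 2^(k+1) for k < n add up to delta - delta / 2^n, less than the charge of
   [B l], so [Q n] is nonempty. *)
have BQ n l : (n <= l.+1)%N -> m (B l `\` Q n) <= delta - delta / 2 ^+ n.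
  elim: n => [|n IH] nl.
    rewrite (_ : B l `\` Q 0%N = set0) ?charge0//; first by rewrite expr0 divr1 subrr.
    by apply/seteqP; split => // x [_] []; move=> k; rewrite ltn0.
  have sub : B l `\` Q n.+1 `<=` (B l `\` Q n) `|` (B l `\` K n).
    move=> x [Bl nQ]; have [Kn|nK] := pselect (K n x); last by right.
    left; split => // Qn; apply: nQ => k; rewrite ltnS leq_eqVlt.
    by case/orP => [/eqP ->//|/Qn].
  apply: (le_trans (charge_subU mm sub)).
  have := lerD (IH (ltnW nl)) (BK n l nl).
  suff -> : delta - delta / 2 ^+ n + delta / 2 ^+ n.+1 = delta - delta / 2 ^+ n.+1 by [].
  by rewrite exprS; field; rewrite expf_neq0.
have Q0 n : Q n !=set0.
  have [//|/set0P/negP/negPn/eqP Qn] := pselect (Q n !=set0).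
  have := BQ n n (leqnSn n); rewrite Qn setD0.
  have := mB n; have : 0 < delta / 2 ^+ n by rewrite divr_gt0// exprn_gt0.
  by lra.
pose F := filter_from [set: nat] Q.
have FF : Filter F.
  apply: filter_fromT_filter; first by exists 0%N.
  move=> i j; exists (maxn i j) => x Qx; split => k ki; apply: Qx.
    by rewrite leq_max ki.
  by rewrite leq_max ki orbT.
have PF : ProperFilter F by apply: filter_from_proper.
have [U [UU FU]] := ultraFilterLemma PF.
exists U => // n; apply: (@ultra_bigcup_nat _ U UU B n (N n)).
by apply: FU; exists n.+1 => // x; apply.
Qed.

(** Limits along a free ultrafilter on the indices exist because all values lie in the compact
    interval [0, 1]; they preserve additivity and any bound valid for all large n. *)
Lemma charge_ultralimit (R : realType) (X : Type) (p : nat -> set X -> R)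
    (B : nat -> set X) (delta : R) :
  (forall n, is_charge (p n)) -> (forall i n, (i <= n)%N -> delta <= p n (B i)) ->
  exists2 m : set X -> R, is_charge m & forall i, delta <= m (B i).
Proof.
move=> pc pB.
have [U [UU oU]] := ultraFilterLemma (eventually_filter).
have lim (A : set X) : exists l : R, p n A @[n --> U] --> l.
  have UA : UltraFilter (p n A @[n --> U]).
    split; first exact: fmap_proper_filter.
    move=> G PG sub; apply/seteqP; split => // S GS.
    have [//|UC] := in_ultra_setVsetC ((fun n => p n A) @^-1` S) UU.
    have : G (~` S) by apply: sub.
    by move=> /(filterI GS); rewrite setICr => /filter_ex[].
  have := @segment_compact R 0 1; rewrite compact_ultra => /(_ _ UA).
  case=> [|l [_ ll]]; last by exists l.
  apply: (@filterE _ U) => n /=; rewrite in_itv/=.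
  by rewrite (charge_ge0 (pc n)) (charge_le1 (pc n)).
have {lim} [m ml] := choice lim.
exists m; first split.
- move=> A; apply: cvgr_to_ge (ml A) _; apply: filterE => n; exact: charge_ge0.
- move=> A; apply: cvgr_to_le (ml A) _; apply: filterE => n; exact: charge_le1.
- move=> A C AC.
  have mAC : p n A + p n C @[n --> U] --> m (A `|` C).
    suff -> : (fun n => p n A + p n C) = (fun n => p n (A `|` C)) by exact: ml.
    by apply/funext => n; rewrite (chargeU (pc n)).
  exact: norm_cvg_unique mAC (cvgD (ml A) (ml C)).
- move=> i; apply: cvgr_to_ge (ml _) _; apply: oU.
  by exists i => // n /= ni; exact: pB.
Qed.

(** The form of Ptak's lemma applied below, first to measures on edges and then to measures on
    vertices. The measure may change with n and only has to charge the first n + 1 sets. *)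
Lemma charges_ultrafilter (R : realType) (X : Type) (p : nat -> set X -> R)
    (B : nat -> set X) (delta : R) :
  (forall n, is_charge (p n)) -> 0 < delta ->
  (forall i n, (i <= n)%N -> delta <= p n (B i)) ->
  exists2 U : set_system X, UltraFilter U & forall n, exists j, (n <= j)%N /\ U (B j).
Proof.
move=> pc d0 pB; have [m mc mB] := charge_ultralimit pc pB.
exact: charge_ultrafilter mc d0 mB.
Qed.

Definition freq (R : realType) (X : choiceType) (s : seq X) (A : set X) : R :=
  (\sum_(x <- s) (x \in A)%:R) / (size s)%:R.

Lemma freq_charge (R : realType) (X : choiceType) (s : seq X) :
  is_charge (freq R s).
Proof.
split=> [A|A|A B AB].
- by rewrite divr_ge0// sumr_ge0.
- have [->|s0] := eqVneq s [::]; first by rewrite /freq big_nil mul0r ler01.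
  rewrite ler_pdivrMr ?ltr0n ?lt0n ?size_eq0// mul1r -sum1_size natr_sum.
  by apply: ler_sum => x _; rewrite ler_nat leq_b1.
- rewrite /freq -mulrDl -big_split/=; congr (_ / _); apply: eq_bigr => x _.
  rewrite in_setU -natrD; congr _%:R.
  have := @in_set0 _ x; rewrite -AB in_setI.
  by case: (x \in A) (x \in B) => [] [].
Qed.

Lemma eq_freq (R : realType) (X : choiceType) (s : seq X) (A B : set X) :
  (forall x, x \in s -> A x <-> B x) -> freq R s A = freq R s B.
Proof.
move=> AB; congr (_ / _); apply: eq_big_seq => x xs; congr (nat_of_bool _)%:R.
by apply/idP/idP; rewrite !inE => /(AB _ xs).
Qed.

(** * Extended-real sums and weak duality *)

Section ESum.
Local Open Scope ereal_scope.

(** The summand is the density of a finite combination of point masses [w k] at [x k]. Matchings and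
    covers are built in this form, and their sums become finite ones. *)
Lemma esum_atoms (R : realType) (K Y : choiceType) (r : seq K) (w : K -> R)
    (x : K -> Y) (A : set Y) : (forall k, 0 <= w k)%R ->
  \esum_(y in A) (\sum_(k <- r) w k * (x k == y)%:R)%R%:E =
  (\sum_(k <- r) w k * (x k \in A)%:R)%R%:E.
Proof.
move=> w0; under eq_esum do rewrite -sumEFin.
rewrite esum_sum => [|y k _ _]; last by rewrite lee_fin mulr_ge0.
rewrite -sumEFin; apply: eq_bigr => k _.
transitivity (\esum_(y in A `&` [set x k]) (w k)%:E).
  rewrite esum_mkcondr; apply: eq_esum => y _.
  have [<-|xy] := eqVneq (x k) y; first by rewrite mem_set// mulr1.
  by rewrite memNset ?mulr0//= => yx; rewrite yx eqxx in xy.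
have [Ax|nAx] := boolP (x k \in A).
  rewrite mulr1 setIidr; first by rewrite esum_set1// lee_fin.
  by move=> _ ->; exact: set_mem.
rewrite mulr0 [X in esum X](_ : _ = set0) ?esum_set0//.
by apply/seteqP; split => // y [Ay yx]; rewrite -yx mem_set in nAx.
Qed.

Lemma esumZl_le (R : realType) (Y : choiceType) (A : set Y) (c : R) (a : Y -> R) :
  (0 <= c)%R -> (forall y, A y -> 0 <= a y)%R ->
  \esum_(y in A) (c * a y)%R%:E <= c%:E * \esum_(y in A) (a y)%:E.
Proof.
move=> c0 a0; apply: ge_ereal_sup => _ [X [finX XA] <-].
apply: (@le_trans _ _ (c%:E * \sum_(y \in X) (a y)%:E)).
  by rewrite !fsbig_finite//= !sumEFin -EFinM mulr_sumr.
apply: lee_wpmul2l; first by rewrite lee_fin.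
by apply: ereal_sup_ubound; exists X.
Qed.

Lemma esumZl (R : realType) (Y : choiceType) (A : set Y) (c : R) (a : Y -> R) :
  (0 <= c)%R -> (forall y, A y -> 0 <= a y)%R ->
  \esum_(y in A) (c * a y)%R%:E = c%:E * \esum_(y in A) (a y)%:E.
Proof.
move=> c0 a0; apply/eqP; rewrite eq_le esumZl_le//=.
have [->|cn0] := eqVneq c 0%R.
  by rewrite mul0e esum_ge0// => y _; rewrite lee_fin mul0r.
have cp : (0 < c)%R by rewrite lt_neqAle eq_sym cn0.
rewrite -lee_pdivlMl//.
apply: le_trans (esumZl_le _ _); last 2 first.
- by rewrite invr_ge0.
- by move=> y /a0 ?; rewrite mulr_ge0.
by apply: le_esum => y _; rewrite mulrA mulVf// mul1r.
Qed.

End ESum.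

(** Both sizes are compared with the sum of [f e * g v] over incident pairs: summing along edges
    uses the cover condition, summing along vertices the matching condition. *)
Lemma nu_le_tau (R : realType) (T : choiceType) (V : set T) (E : set (set T)) :
  is_hypergraph V E -> (nu_star R V E <= tau_star R V E)%E.
Proof.
move=> EV; apply: ge_ereal_sup => _ [f [f0 f1] <-].
apply: le_ereal_inf_tmp => _ [g [g0 g1] <-].
have fg0 e v : E e -> e v -> (0 <= (f e * g v)%:E)%E.
  by move=> Ee ev; rewrite lee_fin mulr_ge0 ?f0 ?g0//; exact: EV ev.
apply: (@le_trans _ _ (\esum_(e in E) \esum_(v in e) (f e * g v)%:E)%E).
  apply: le_esum => e Ee; rewrite esumZl ?f0// => [|v ev]; last exact/g0/(EV e).
  by rewrite -[leLHS]mule1 lee_wpmul2l ?lee_fin ?f0 ?g1.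
rewrite (esum_esum (J := id))//.
apply: (@le_trans _ _
    (\esum_(v in V) \esum_(e in [set e | E e /\ e v]) (f e * g v)%:E)%E).
  rewrite (esum_esum (J := fun v => [set e | E e /\ e v])); last first.
    by move=> v e _ [Ee ev]; exact: fg0.
  rewrite (reindex_esum (V `*`` (fun v => [set e | E e /\ e v])) _
    (fun x => (x.2, x.1)))//; split => /=.
  + by move=> [v e] /= [_ [Ee ev]].
  + by move=> [v e] [v' e'] /= _ _ [-> ->].
  + move=> [e v] /= [Ee ev]; exists (v, e) => //=; split => //; exact: EV ev.
apply: le_esum => v Vv; under eq_esum do rewrite mulrC.
rewrite esumZl ?g0// => [|e [/f0]//].
by rewrite -[leRHS]mule1 lee_wpmul2l ?lee_fin ?f1 ?g0.
Qed.

Lemma finite_set_nat_bound (X : choiceType) (A : set X) (f : X -> nat) :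
  finite_set A -> exists N, forall x, A x -> (f x < N)%N.
Proof.
move=> finA; exists (\max_(x <- finmap.enum_fset (fset_set A)) f x).+1 => x Ax.
by rewrite ltnS leq_bigmax_seq// in_fset_set// mem_set.
Qed.

(** * The tail hypergraph *)

Section Tail.
Variables (R : realType) (T : choiceType) (V : set T) (E : set (set T)).
Hypothesis tailVE : iso_tail V E.

(** Finitely many tails share a vertex, and the matching condition there bounds every finite partial
    sum. *)
Lemma tail_nu_le1 : (nu_star R V E <= 1)%E.
Proof.
have [phi [[_ phi_inj phi_surj] [EV [Etail _]]]] := tailVE.
apply: ge_ereal_sup => _ [f [f0 f1] <-]; apply: ge_ereal_sup => _ [X [finX XE] <-].
have /choice[j jP] : forall e, exists j, E e -> phi @` e = tail_edge j.
  move=> e; have [/Etail[j ej]|] := pselect (E e); first by exists j.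
  by exists 0%N.
have [N NP] := finite_set_nat_bound j finX.
have [v Vv vN] := phi_surj N I.
apply: le_trans (f1 v Vv); apply: esum_ge; exists X => //; split => // e Xe.
have Ee := XE _ Xe; split => //.
have : (phi @` e) N by rewrite jP// /tail_edge/= ltnW// NP.
move=> [u eu uN]; suff -> : v = u by [].
by apply: phi_inj; rewrite ?inE ?vN ?uN//; exact: EV eu.
Qed.

(** Every finite vertex set misses some edge, which adds fresh weight to the sum. A finite part of
    that edge need not reach weight 1, so 1/2 is gained each time. *)
Lemma tail_tau : tau_star R V E = +oo%E.
Proof.
have [phi [_ [EV [_ tailE]]]] := tailVE.
suff cov g : frac_cover V E g -> frac_cover_size V g = +oo%E :> \bar R.
  apply/eqP; rewrite -leye_eq; apply: le_ereal_inf_tmp => _ [g gcov <-].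
  by rewrite cov.
move=> [g0 g1].
have big n : exists2 D, fsets V D & ((n%:R / 2)%:E <= \sum_(v \in D) (g v)%:E)%E.
  elim: n => [|n [D [finD DV] Dn]].
    by exists set0; [exact: fsets_set0|rewrite fsbig_set0 mul0r].
  have [N NP] := finite_set_nat_bound phi finD.
  have [e [Ee eN]] := tailE N.
  have : ((1 / 2)%:E < \esum_(v in e) (g v)%:E)%E.
    by apply: lt_le_trans (g1 e Ee); rewrite lte_fin; lra.
  move=> /ereal_sup_gt[_ [D' [finD' D'e] <-] D'2].
  have DD' : D `&` D' = set0.
    apply/seteqP; split => // v [/NP + /D'e ev].
    have : (phi @` e) (phi v) by exists v.
    by rewrite eN /tail_edge/= leqNgt => /negP.
  exists (D `|` D').
    split; first by rewrite finite_setU.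
    by move=> v [/DV//|/D'e]; exact: EV.
  rewrite fsbigU//=; last by move=> v; rewrite DD'.
  rewrite -natr1 mulrDl EFinD; apply: leeD => //; exact: ltW.
apply: eq_infty => y.
pose n := (Num.truncn (2 * `|y|)).+1.
have [D DV Dn] := big n.
apply: esum_ge; exists D => //; apply: le_trans Dn; rewrite lee_fin.
have := truncnS_gt (2 * `|y|); rewrite -/n; have := ler_norm y; lra.
Qed.

End Tail.

(** * Covers of finitely many edges, and failure of small covers *)

Lemma nu_star_ge0 (R : realType) (T : choiceType) (V : set T) (E : set (set T)) :
  (0 <= nu_star R V E)%E.
Proof.
apply: ereal_sup_ubound; exists (fun=> 0); last by rewrite /frac_matching_size esum1.
by split => // v _; rewrite esum1// lee01.
Qed.

(* For c' between nu* and c, a probability vector w on L scaled by c' is too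
   large to be a matching, so some vertex has w-degree above 1/c'. *)
Lemma finite_cover (R : realType) (T : choiceType) (V : set T) (E : set (set T))
    (c : R) (L : seq (set T)) :
  (nu_star R V E < c%:E)%E -> L != [::] -> (forall e, e \in L -> E e) ->
  exists s : seq T, [/\ s != [::], (forall v, v \in s -> V v) &
    forall e, e \in L -> c^-1 <= freq R s e].
Proof.
move=> nuc L0 LE.
have [c' nuc' c'c] : exists2 c' : R, (nu_star R V E < c'%:E)%E & c' < c.
  have := nu_star_ge0 R V E; move: nuc; case: (nu_star R V E) => [r|//|//].
  by rewrite lte_fin => rc _; exists ((r + c) / 2); rewrite ?lte_fin; lra.
have c'0 : 0 < c' by have := le_lt_trans (nu_star_ge0 R V E) nuc'; rewrite lte_fin.
have c0 : 0 < c by apply: lt_trans c'c.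
pose J := 'I_(size L).
pose e_ (j : J) := nth set0 L j.
have e_L j : e_ j \in L by rewrite mem_nth.
pose a v (j : J) : R := (v \in e_ j)%:R - c'^-1.
have ci0 : 0 < c'^-1 by rewrite invr_gt0.
have aM v j : V v -> `|a v j| <= 1 + c'^-1.
  move=> _; rewrite /a ler_norml; case: (v \in e_ j) => /=; lra.
have J0 : (0 < #|J|)%N by rewrite card_ord lt0n size_eq0.
have value (w : J -> R) : (forall j, 0 <= w j) -> \sum_j w j = 1 ->
    exists2 v, V v & 0 <= \sum_j w j * a v j.
  move=> w0 w1.
  (* Summing over indices lets an edge repeated in [L] collect all of its weights. *)
  pose f e : R := \sum_j c' * w j * (e_ j == e)%:R.
  have cw0 j : 0 <= c' * w j by rewrite mulr_ge0// ltW.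
  have f_size A : (\esum_(e in A) (f e)%:E)%E =
    (\sum_j c' * w j * (e_ j \in A)%:R)%:E by rewrite esum_atoms.
  apply: contrapT => no_v; suff : (c'%:E <= nu_star R V E)%E by rewrite leNgt nuc'.
  apply: ereal_sup_ubound; exists f; last first.
    rewrite /frac_matching_size f_size; congr EFin.
    transitivity (c' * \sum_j w j); last by rewrite w1 mulr1.
    rewrite mulr_sumr; apply: eq_bigr => j _.
    have -> : e_ j \in E by rewrite inE; exact/LE/e_L.
    by rewrite mulr1.
  split=> [e _|v Vv]; first by apply: sumr_ge0 => j _; rewrite mulr_ge0.
  rewrite f_size lee_fin leNgt; apply/negP => gt1; apply: no_v; exists v => //.
  have mE j : (e_ j \in [set e | E e /\ e v]) = (v \in e_ j).
    apply/idP/idP => /set_mem; first by case=> _ /mem_set.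
    by move=> ev; apply: mem_set; split => //; exact/LE/e_L.
  suff -> : \sum_j w j * a v j = c'^-1 * ((\sum_j c' * w j *
      (e_ j \in [set e | E e /\ e v])%:R) - \sum_j w j).
    by rewrite w1 mulr_ge0// ?ltW// subr_gt0.
  rewrite -sumrB mulr_sumr; apply: eq_bigr => j _; rewrite mE /a; field.
  by rewrite gt_eqF.
(* The slack between [c'] and [c] pays for the error of the approximate minimax. *)
have [|s [s0 sV sP]] := approx_minimax J0 aM value (_ : 0 < c'^-1 - c^-1).
  by rewrite subr_gt0 ltf_pV2.
exists s; split => // e eL.
have jL : (index e L < size L)%N by rewrite index_mem.
have := sP (Ordinal jL); rewrite /a /e_/= nth_index//.
rewrite big_split/= sumrN big_const_seq count_predT iter_addr_0.
rewrite /freq ler_pdivlMr ?ltr0n ?lt0n ?size_eq0// -mulr_natr.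
set F := \sum_(v <- s) _; lra.
Qed.

(** The mixture of the measures [s i], scaled by [c], has size at most c < tau*, so it is not a
    cover and some edge is undercovered. *)
Lemma cover_fails (R : realType) (T : choiceType) (V : set T) (E : set (set T))
    (c : R) (n : nat) (s : 'I_n -> seq T) (w : 'I_n -> R) :
  0 < c -> (c%:E < tau_star R V E)%E -> (forall i v, v \in s i -> V v) ->
  (forall i, 0 <= w i) -> \sum_i w i = 1 ->
  exists2 e, E e & \sum_i w i * freq R (s i) e <= c^-1.
Proof.
move=> c0 ctau sV w0 w1.
pose r := [seq (i, v) | i <- enum 'I_n, v <- s i].
pose u (k : 'I_n * T) : R := c * w k.1 / (size (s k.1))%:R.
have u0 k : 0 <= u k by rewrite divr_ge0// mulr_ge0// ltW.
pose g v : R := \sum_(k <- r) u k * (k.2 == v)%:R.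
have g_size A : (\esum_(v in A) (g v)%:E)%E = (c * \sum_i w i * freq R (s i) A)%:E.
  rewrite (esum_atoms r snd A u0); congr EFin; rewrite big_allpairs_dep.
  rewrite big_enum/= mulr_sumr; apply: eq_bigr => i _; rewrite /freq /u/=.
  by rewrite -mulr_sumr; ring.
apply: contrapT => no_e; move: ctau; rewrite ltNge => /negP; apply.
apply: le_trans (ereal_inf_lbound (_ : _ (frac_cover_size V g))) _.
  exists g => //; split => [v _|e Ee]; first by apply: sumr_ge0 => k _; rewrite mulr_ge0.
  rewrite g_size lee_fin -ler_pdivrMl// mulr1 leNgt; apply/negP => lt.
  by apply: no_e; exists e => //; exact: ltW.
rewrite /frac_cover_size g_size lee_fin -[leRHS]mulr1 ler_wpM2l//; first exact: ltW.
rewrite -w1; apply: ler_sum => i _; rewrite -[leRHS]mulr1 ler_wpM2l//.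
exact: charge_le1 (freq_charge R (s i)) _.
Qed.

(** * Traces of edges on finite supports *)

Lemma trace_representatives (T : choiceType) (E : set (set T)) (s : seq T) :
  exists L : seq (set T), (forall e, e \in L -> E e) /\
    (forall e, E e -> exists2 e', e' \in L & forall v, v \in s -> e v <-> e' v).
Proof.
elim: s E => [|v s IH] E.
  have [[e0 Ee0]|nE] := pselect (exists e, E e).
    exists [:: e0]; split; first by move=> e; rewrite inE => /eqP ->.
    by move=> e _; exists e0 => //; rewrite inE.
  by exists [::]; split => // e Ee; case: nE; exists e.
have [L1 [L1E L1P]] := IH [set e | E e /\ e v].
have [L2 [L2E L2P]] := IH [set e | E e /\ ~ e v].
exists (L1 ++ L2); split => [e|e Ee].
  by rewrite mem_cat => /orP[/L1E[]|/L2E[]].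
have [ev|nev] := pselect (e v).
  have [e' e'L es] := L1P e (conj Ee ev); exists e'; first by rewrite mem_cat e'L.
  by move=> x; rewrite inE => /orP[/eqP ->|/es//]; have [] := L1E _ e'L.
have [e' e'L es] := L2P e (conj Ee nev); exists e'; first by rewrite mem_cat e'L orbT.
by move=> x; rewrite inE => /orP[/eqP ->|/es//]; have [] := L2E _ e'L.
Qed.

(** Representatives of the finitely many traces on the supports before n join the list that [s n]
    must handle, and this list never shrinks. *)
Lemma interleaved_covers (T : choiceType) (E : set (set T))
    (G : set (seq T)) (P : seq T -> set T -> Prop) :
  E !=set0 ->
  (forall L : seq (set T), L != [::] -> (forall e, e \in L -> E e) ->
     exists2 s, G s & forall e, e \in L -> P s e) ->
  exists s : nat -> seq T, (forall n, G (s n)) /\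
    forall n e, E e -> exists e', [/\ E e',
      forall i v, (i < n)%N -> v \in s i -> e v <-> e' v &
      forall i, (n <= i)%N -> P (s i) e'].
Proof.
move=> [e0 Ee0] cov.
have /choice[F FP] : forall L : seq (set T), exists s, L != [::] ->
    (forall e, e \in L -> E e) -> G s /\ forall e, e \in L -> P s e.
  move=> L; have [[L0 LE]|nL] := pselect (L != [::] /\ forall e, e \in L -> E e).
    by have [s Gs Ps] := cov L L0 LE; exists s.
  by exists [::] => L0 LE; case: nL.
have /choice[H HP] := trace_representatives E.
(* [(st n).1] concatenates the supports of the [s i] with i < n; [(st n).2] lists the edges that
   [s n] has to handle. The edge [e0] keeps this list nonempty. *)
pose st := fix st n := if n is n'.+1 then
  let W := (st n').1 ++ F (st n').2 in (W, (st n').2 ++ H W)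
  else ([::] : seq T, e0 :: H [::]).
pose s n := F (st n).2.
have stE n e : e \in (st n).2 -> E e.
  elim: n e => [|n IH] e /=.
    by rewrite inE => /orP[/eqP ->//|]; exact: (HP _).1.
  by rewrite mem_cat => /orP[/IH//|]; exact: (HP _).1.
have st0 n : (st n).2 != [::].
  by elim: n => //= n; case: (st n).2.
have stH n : {subset H (st n).1 <= (st n).2}.
  case: n => [|n] e /= eH; first by rewrite inE eH orbT.
  by rewrite mem_cat eH orbT.
have st_mono n m : (n <= m)%N -> {subset (st n).2 <= (st m).2}.
  move=> /subnK <-; elim: (m - n)%N => [//|k IH] e /IH eL.
  by rewrite addSn/= mem_cat eL.
have st1 n i v : (i < n)%N -> v \in s i -> v \in (st n).1.
  elim: n => [//|n IH]; rewrite ltnS leq_eqVlt /= mem_cat.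
  by case/orP => [/eqP -> ->|/IH/[apply] ->]; rewrite ?orbT.
exists s; split => [n|n e Ee]; first by have [] := FP _ (st0 n) (@stE n).
have [e' e'L ee'] := (HP (st n).1).2 e Ee.
exists e'; split; first exact: (HP _).1 e'L.
  by move=> i v /st1/[apply]; exact: ee'.
move=> i ni; have [_] := FP _ (st0 i) (@stE i); apply.
exact/(st_mono n)/stH.
Qed.

(** For each vertex the ultrafilter decides between the edges containing it and those missing it;
    finitely many decisions hold together. *)
Lemma ultra_trace (T : choiceType) (U : set_system (set T)) (UU : UltraFilter U)
    (s : seq T) :
  U [set e : set T | forall v, v \in s -> e v <-> U [set e' : set T | e' v]].
Proof.
elim: s => [|v s IH]; first exact: filterE.
have Uv : U [set e : set T | e v <-> U [set e' : set T | e' v]].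
  have [Uv|Uv] := in_ultra_setVsetC [set e : set T | e v] UU.
    by apply: filterS (Uv) => e /= ev.
  apply: filterS (Uv) => e /= nev; split => // Uv'.
  by have [e' []] := filter_ex (filterI Uv Uv').
apply: filterS (filterI IH Uv) => e /= [es ev] x.
by rewrite inE => /orP[/eqP ->//|/es].
Qed.

(** * Half graphs and tails *)

Lemma half_graph_tail (T : choiceType) (V : set T) (E : set (set T))
    (v : nat -> T) (e : nat -> set T) :
  (forall k, V (v k)) -> (forall j, E (e j)) ->
  (forall j k, e j (v k) <-> (j <= k)%N) ->
  exists V' E', partial_sub V E V' E' /\ iso_tail V' E'.
Proof.
move=> Vv Ee ev.
(* The half graph separates its vertices, so the index of a vertex serves as the isomorphism after
   restriction to the range of [v]. *)
have v_inj : injective v.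
  move=> k l kl; apply/eqP; rewrite eqn_leq; apply/andP; split; apply/ev.
    by rewrite -kl; apply/ev.
  by rewrite kl; apply/ev.
have /choice[phi phiP] : forall x, exists k, range v x -> v k = x.
  move=> x; have [[k _ <-]|] := pselect (range v x); first by exists k.
  by exists 0%N.
have phiv k : phi (v k) = k by apply: v_inj; apply: phiP; exists k.
have phie j : phi @` (e j `&` range v) = tail_edge j.
  apply/seteqP; split => [_ [x [ex [k _ vx]] <-]|k jk].
    by rewrite -vx phiv; apply/ev; rewrite vx.
  by exists (v k); [split; [exact/ev|exists k]|exact: phiv].
exists (range v), [set e' `&` range v | e' in range e]; split.
  split; first by move=> _ [k _ <-].
  by exists (range e); split => // _ [j _ <-].
exists phi; split; first split => //.
- by move=> _ _ /set_mem[k _ <-] /set_mem[l _ <-]; rewrite !phiv => ->.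
- by move=> k _; exists (v k); [exists k|exact: phiv].
split; first by move=> _ [e' _ <-]; exact: subIsetr.
split; first by move=> _ [_ [j _ <-] <-]; exists j.
by move=> j; exists (e j `&` range v); split => //; exists (e j) => //; exists j.
Qed.

(** Edges and vertices are chosen alternately. The state is a set of [U] inside all edges chosen so
    far, with a lower bound for the next index. A new vertex is taken in this set and in the new
    edge; the bound then moves past all edges containing that vertex. *)
Lemma ultrafilter_half_graph (T : choiceType) (V : set T) (e : nat -> set T)
    (U : set_system T) :
  ProperFilter U ->
  (forall n, exists j, (n <= j)%N /\
     U [set v | [/\ V v, e j v & exists N, forall k, (N <= k)%N -> ~ e k v]]) ->
  exists (v : nat -> T) (j : nat -> nat), (forall k, V (v k)) /\
    forall l k, e (j l) (v k) <-> (l <= k)%N.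
Proof.
move=> PU UB.
pose B j := [set v | [/\ V v, e j v & exists N, forall k, (N <= k)%N -> ~ e k v]].
have /choice[F FP] : forall x : set T * nat, exists y : nat * T * nat, U x.1 ->
    let: (j, v, N) := y in
    [/\ (x.2 <= j)%N, U (B j), (x.1 `&` B j) v, (j < N)%N &
        forall k, (N <= k)%N -> ~ e k v].
  move=> [A n] /=; have [UA|nUA] := pselect (U A); last first.
    by have [v _] := filter_ex (@filterT _ U _); exists (0%N, v, 0%N).
  have [j [nj Uj]] := UB n.
  have [v ABv] := filter_ex (filterI UA Uj).
  have [_ [_ _ [N NP]]] := ABv.
  (* The maximum with [j.+1] makes the lower bounds increase. *)
  exists (j, v, maxn N j.+1) => _; split => //; first by rewrite leq_maxr.
  by move=> k; rewrite geq_max => /andP[/NP].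
pose st := fix st n : set T * nat := if n is n'.+1 then
  ((st n').1 `&` B (F (st n')).1.1, (F (st n')).2) else (setT, 0%N).
pose j n := (F (st n)).1.1.
pose v n := (F (st n)).1.2.
have stP n : U (st n).1 /\
    [/\ ((st n).2 <= j n)%N, U (B (j n)), (st n.+1).1 (v n),
        (j n < (st n.+1).2)%N & forall k, ((st n.+1).2 <= k)%N -> ~ e k (v n)].
  have FPn : U (st n).1 -> [/\ ((st n).2 <= j n)%N, U (B (j n)), (st n.+1).1 (v n),
        (j n < (st n.+1).2)%N & forall k, ((st n.+1).2 <= k)%N -> ~ e k (v n)].
    by have := FP (st n); rewrite /j /v/=; case: (F (st n)) => [[]].
  suff : U (st n).1 by split => //; exact: FPn.
  elim: n {FPn} => [|n IH]; first exact: filterT.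
  have := FP (st n) IH; rewrite /=; case: (F (st n)) => [[j' v'] N'] [_ Uj _ _ _] /=.
  exact: filterI.
have st1 n m : (n <= m)%N -> (st m).1 `<=` (st n).1.
  by move=> /subnK <-; elim: (m - n)%N => [//|k IH] x [/IH].
have st2 n m : (n <= m)%N -> ((st n).2 <= (st m).2)%N.
  move=> /subnK <-; elim: (m - n)%N => [//|k IH]; apply: (leq_trans IH).
  have [_ [h1 _ _ h2 _]] := stP (k + n)%N; rewrite addSn.
  exact: leq_trans h1 (ltnW h2).
exists v, j; split => [k|l k].
  by have [_ [_ _ [_ []]]] := stP k.
have [_ [_ _ Av _ out]] := stP k.
split => [evk|lk].
  rewrite leqNgt; apply/negP => kl; apply: out evk.
  have [_ [h _ _ _ _]] := stP l; exact: leq_trans (st2 _ _ kl) h.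
by have [_ []] := st1 l.+1 k.+1 lk _ Av.
Qed.

(** * From a duality gap to a tail *)

(** Markov's inequality: entries with h >= b contribute at least b each, so their share is at most a
    / b. *)
Lemma freq_markov (R : realType) (X : choiceType) (t : seq X) (D : set X)
    (h : X -> R) (a b : R) :
  t != [::] -> 0 < b -> (forall x, x \in t -> D x) -> (forall x, 0 <= h x) ->
  \sum_(x <- t) h x <= a * (size t)%:R ->
  1 - a / b <= freq R t [set x | D x /\ h x < b].
Proof.
move=> t0 b0 tD h0 hle; pose A := [set x | D x /\ h x < b].
have n0 : 0 < (size t)%:R :> R by rewrite ltr0n lt0n size_eq0.
have hA : b * (\sum_(x <- t) (1 - (x \in A)%:R)) <= \sum_(x <- t) h x.
  rewrite mulr_sumr big_seq [leRHS]big_seq; apply: ler_sum => x xt.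
  have [|nA] := boolP (x \in A); first by rewrite subrr mulr0.
  rewrite subr0 mulr1 leNgt; apply: contra nA => hb.
  by apply: mem_set; split => //; exact: tD.
move: hA; rewrite sumrB big_const_seq count_predT iter_addr_0 -/A /freq.
set F := \sum_(x <- t) (x \in A)%:R => hA.
rewrite ler_pdivlMr// -(ler_pM2l b0).
have -> : b * ((1 - a / b) * (size t)%:R) = b * (size t)%:R - a * (size t)%:R.
  by field; rewrite gt_eqF.
by move: hA; rewrite mulrBr; lra.
Qed.

Lemma duality_gap_tail (R : realType) (T : choiceType) (V : set T) (E : set (set T)) :
  (nu_star R V E < tau_star R V E)%E ->
  exists V' E', partial_sub V E V' E' /\ iso_tail V' E'.
Proof.
move=> gap.
have [c [c1 [nuc cc1 c1tau]]] : exists c c1 : R,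
    [/\ (nu_star R V E < c%:E)%E, c < c1 & (c1%:E < tau_star R V E)%E].
  have := nu_star_ge0 R V E; move: gap.
  case: (tau_star R V E) => [q| |]; case: (nu_star R V E) => [r| |] //.
    rewrite lte_fin => rq _; exists ((2 * r + q) / 3), ((r + 2 * q) / 3).
    by rewrite !lte_fin; split; lra.
  by exists (r + 1), (r + 2); rewrite lte_fin ltry; split => //; lra.
have c0 : 0 < c by have := le_lt_trans (nu_star_ge0 R V E) nuc; rewrite lte_fin.
have c10 : 0 < c1 by exact: lt_trans cc1.
have E0 : E !=set0.
  (* Even the zero measure, given by one empty list, must fail on some edge. *)
  have [e Ee _] := @cover_fails R T V E c1 1 (fun=> [::]) (fun=> 1) c10 c1tau
    (fun _ _ => ltac:(by [])) (fun=> ler01) (big_ord1 _ _).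
  by exists e.
have [|s [sG s_rep]] := @interleaved_covers T E
    [set s | s != [::] /\ forall v, v \in s -> V v] (fun s e => c^-1 <= freq R s e) E0.
  by move=> L L0 LE; have [s [s0 sV sL]] := finite_cover nuc L0 LE; exists s.
(* Here c^-1 = kappa + 4 eps and theta = kappa + 2 eps. As theta exceeds kappa + eps, the Markov
   bound is positive; as theta is below c^-1, mass 2 eps remains outside [S]. *)
pose kappa := c1^-1; pose eps := (c^-1 - kappa) / 4.
have k0 : 0 < kappa by rewrite invr_gt0.
have eps0 : 0 < eps by rewrite divr_gt0// subr_gt0 ltf_pV2.
pose theta := kappa + 2 * eps.
have theta0 : 0 < theta by rewrite /theta; lra.
pose Bad i := [set e | E e /\ freq R (s i) e < theta].
have /choice[t tP] : forall n, exists t : seq (set T), forall i, (i <= n)%N ->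
    1 - (kappa + eps) / theta <= freq R t (Bad i).
  move=> n.
  have J0 : (0 < #|'I_n.+1|)%N by rewrite card_ord.
  have aM (e : set T) (i : 'I_n.+1) : E e -> `|kappa - freq R (s i) e| <= 1 + kappa.
    move=> _; have := charge_ge0 (freq_charge R (s i)) e.
    have := charge_le1 (freq_charge R (s i)) e; rewrite ler_norml; lra.
  have value (w : 'I_n.+1 -> R) : (forall i, 0 <= w i) -> \sum_i w i = 1 ->
      exists2 e, E e & 0 <= \sum_i w i * (kappa - freq R (s i) e).
    move=> w0 w1.
    have [e Ee le] := @cover_fails R T V E c1 n.+1 (fun i => s i) w c10 c1tau
      (fun i => (sG i).2) w0 w1.
    exists e => //; under eq_bigr do rewrite mulrBr.
    by rewrite sumrB -mulr_suml w1 mul1r subr_ge0.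
  have [t [t0 tE tle]] := approx_minimax J0 aM value eps0.
  exists t => i ni; apply: freq_markov => //.
    by move=> e; exact: charge_ge0 (freq_charge R (s i)) e.
  have := tle (Ordinal (ni : (i < n.+1)%N)).
  rewrite big_split/= sumrN big_const_seq count_predT iter_addr_0 -mulr_natr.
  by set F := \sum_(e <- t) _; lra.
have delta0 : 0 < 1 - (kappa + eps) / theta.
  by rewrite subr_gt0 ltr_pdivrMr// mul1r /theta; lra.
have [U UU UBad] := charges_ultrafilter (fun n => freq_charge R (t n)) delta0
  (fun i n => tP n i).
pose S := [set v | U [set e | e v]].
(* Some edge in [Bad i] has the same trace as [S] on the support of [s i]. *)
have freqS i : U (Bad i) -> freq R (s i) S < theta.
  move=> Ui; have [e [[_ lt] es]] := filter_ex (filterI Ui (ultra_trace UU (s i))).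
  by rewrite -(eq_freq R es).
have UE : U E.
  by have [j [_ Uj]] := UBad 0%N; apply: filterS Uj => e [].
have /choice[e eP] : forall n, exists e, [/\ E e,
    forall i v, (i < n)%N -> v \in s i -> e v <-> S v &
    forall i, (n <= i)%N -> c^-1 <= freq R (s i) e].
  (* An edge with the trace of [S] on the first n supports is replaced by its representative, which
     all later covers handle. *)
  move=> n; have [e [Ee es]] := filter_ex (filterI UE
    (ultra_trace UU (flatten [seq s i | i <- iota 0 n]))).
  have [e' [Ee' e'e e'c]] := s_rep n e Ee.
  exists e'; split => // i v ni vs; rewrite -(e'e i v ni vs); apply: es.
  by apply/flattenP; exists (s i) => //; apply: map_f; rewrite mem_iota.
have /choice[i_ iP] := UBad.
pose B j := [set v | [/\ V v, e j v & exists N, forall k, (N <= k)%N -> ~ e k v]].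
(* The edge [e j] has mass at least c^-1 and [S] less than theta. A support point outside [S] leaves
   [e k] once k > [i_ n], since [e k] agrees with [S] there. *)
have freqB j n : (j <= n)%N -> c^-1 - theta <= freq R (s (i_ n)) (B j).
  move=> jn; have [ni Ui] := iP n.
  have [_ _ /(_ _ (leq_trans jn ni)) ce] := eP j.
  have mm := freq_charge R (s (i_ n)).
  have [sn0 sV] := sG (i_ n).
  rewrite lerBlDl (le_trans ce)//.
  apply: (@le_trans _ _ (freq R (s (i_ n)) (S `|` B j))); last first.
    apply: (le_trans (charge_subU mm (@subset_refl _ _))).
    by rewrite lerD2r; exact/ltW/freqS.
  (* Only points of the support are known to lie in [V] and to leave the edges eventually. *)
  rewrite (@eq_freq _ _ _ (e j) (e j `&` [set v | v \in s (i_ n)])); last first.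
    by move=> v vs; split => [//|[]].
  apply: (le_charge mm) => v [ev /= vs].
  have [Sv|nSv] := pselect (S v); [by left|right; split => //]; first exact: sV.
  by exists (i_ n).+1 => k ik; have [_ /(_ _ _ ik vs) -> _] := eP k.
have ct : 0 < c^-1 - theta.
  by move: eps0; rewrite /theta /eps; lra.
have [W WU WB] := charges_ultrafilter (fun n => freq_charge R (s (i_ n))) ct freqB.
have [v [j [Vv ejv]]] := ultrafilter_half_graph (@ultra_proper _ _ WU) WB.
apply: (half_graph_tail (e := e \o j) Vv _ ejv) => l.
by have [] := eP (j l).
Qed.

Lemma partial_sub_trans (T : Type) (V V' V'' : set T) (E E' E'' : set (set T)) :
  partial_sub V E V' E' -> partial_sub V' E' V'' E'' -> partial_sub V E V'' E''.
Proof.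
move=> [V'V [E0 [E0E ->]]] [V''V' [E1 [E1E ->]]].
split; first exact: subset_trans V'V.
have VV e : e `&` V' `&` V'' = e `&` V'' by rewrite -setIA (setIidr V''V').
(* Traces in [E1] are lifted to the edges of [E0] inducing them. *)
exists [set e | E0 e /\ E1 (e `&` V')]; split; first by move=> e [/E0E].
apply/seteqP; split => [_ [e E1e <-]|_ [e [E0e E1e] <-]].
  have [e' E0e' e'e] := E1E _ E1e; exists e'; first by rewrite /= e'e.
  by rewrite -e'e VV.
by exists (e `&` V').
Qed.

Theorem theorem4p7 (R : realType) (T : choiceType) (V : set T) (E : set (set T)) :
  is_hypergraph V E ->
  ((forall (V' : set T) (E' : set (set T)), partial_sub V E V' E' ->
       nu_star R V' E' = tau_star R V' E') <->
   ~ (exists (V' : set T) (E' : set (set T)), partial_sub V E V' E' /\ iso_tail V' E')).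
Proof.
move=> _; split=> [dual [V' [E' [sub tl]]]|no_tail V' E' sub].
  have := tail_nu_le1 R tl; rewrite (dual _ _ sub) (tail_tau R tl).
  by rewrite leye_eq.
have hyp : is_hypergraph V' E'.
  by case: sub => _ [E0 [_ ->]] _ [e _ <-]; exact: subIsetr.
apply/eqP; rewrite eq_le nu_le_tau//= leNgt; apply/negP => gap.
have [V'' [E'' [sub' tl]]] := duality_gap_tail gap.
by apply: no_tail; exists V'', E''; split => //; exact: partial_sub_trans sub sub'.
Qed.
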